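(* Let $G$ be an abelian group, $\mathcal{D}$ a real algebra isomorphic to $M_n(\mathbb{C})$ for some $n\geq1$, and $\Gamma_0$ a division $G$-grading on the real algebra $\mathcal{D}$ of type (2-f), i.e. such that all nonzero homogeneous components have real dimension $2$ and the identity component $\mathcal{D}_e$ coincides with the center $Z(\mathcal{D})\cong\mathbb{C}$. Let $T\subseteq G$ be the support of $\Gamma_0$ and let $\beta:T\times T\to\mathbb{C}^{\times}$ be the alternating bicharacter given by the commutation relations $X_uX_v=\beta(u,v)X_vX_u$ for $X_u\in\mathcal{D}_u$, $X_v\in\mathcal{D}_v$. Then the Weyl group of $\Gamma_0$ is $$W(\Gamma_0)=\{f\in\operatorname{Aut}(T)\mid\text{either }\beta(f(u),f(v))=\beta(u,v)\ \forall u,v\in T,\ \text{or }\beta(f(u),f(v))=\overline{\beta(u,v)}\ \forall u,v\in T\},$$ and the stabilizer of $\Gamma_0$ is as follows: (i) if $\beta\neq\overline{\beta}$, then all automorphisms in $\operatorname{Stab}(\Gamma_0)$ are inner and $\operatorname{Stab}(\Gamma_0)\cong\operatorname{Hom}(T,\mathbb{C}^{\times})\cong T$; (ii) if $\beta=\overline{\beta}$, then $\operatorname{Stab}(\Gamma_0)\cong T\times\mathbb{Z}_2$.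
   Context: A division $G$-grading on a unital algebra $\mathcal{D}$ is a grading $\mathcal{D}=\bigoplus_{g\in G}\mathcal{D}_g$ ($\mathcal{D}_g\mathcal{D}_h\subseteq\mathcal{D}_{gh}$) in which every nonzero homogeneous element is invertible; its support $T=\{g\mid\mathcal{D}_g\neq0\}$ is then a subgroup of $G$. An isomorphism $\mathcal{D}_e=Z(\mathcal{D})\cong\mathbb{C}$ is fixed, so that $\mathcal{D}$ is regarded as a complex algebra; this gives meaning to the $\mathbb{C}$-valued $\beta$ ($\overline{\beta}$ is its complex conjugate). A $\mathbb{C}$-valued alternating bicharacter is a map $\beta:T\times T\to\mathbb{C}^\times$ with $\beta(uv,w)=\beta(u,w)\beta(v,w)$, $\beta(u,vw)=\beta(u,v)\beta(u,w)$ and $\beta(u,u)=1$ for all $u,v,w\in T$. All automorphisms are automorphisms of real algebras. $\operatorname{Aut}(\Gamma_0)$ is the group of $\mathbb{R}$-algebra automorphisms of $\mathcal{D}$ mapping each homogeneous component onto a homogeneous component; $\operatorname{Stab}(\Gamma_0)$ is the subgroup of those mapping each homogeneous component onto itself; $W(\Gamma_0)=\operatorname{Aut}(\Gamma_0)/\operatorname{Stab}(\Gamma_0)$, which is identified with a subgroup of $\operatorname{Aut}(T)$ by sending the class of $\psi$ to the map $f$ with $\psi(\mathcal{D}_t)=\mathcal{D}_{f(t)}$. *)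

(* Defs.v *)
From HB Require Import structures.
From mathcomp Require Import all_boot all_order all_algebra all_field.
From mathcomp Require Import boolp classical_sets functions cardinality reals.
From mathcomp Require Import complex.

Set Implicit Arguments.
Unset Strict Implicit.
Unset Printing Implicit Defensive.

Import GRing.Theory Num.Theory.

Local Open Scope ring_scope.
Local Open Scope complex_scope.
Local Open Scope classical_set_scope.

(* The grading group is abelian and written additively.  It may be infinite,
   so the decomposition of D as the direct sum of its components is stated
   through finite sums. *)
Record division_grading (K : fieldType) (G : zmodType) (D : falgType K) :=
  DivisionGrading {
    component :> G -> {vspace D};
    component_indep : forall (s : seq G) (x : G -> D), uniq s ->
      (forall g, x g \in component g) -> \sum_(g <- s) x g = 0 ->
      forall g, g \in s -> x g = 0;
    component_span : forall a : D, exists (s : seq G) (x : G -> D),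
      [/\ uniq s, forall g, x g \in component g & a = \sum_(g <- s) x g];
    component_mul : forall g h x y,
      x \in component g -> y \in component h -> x * y \in component (g + h);
    component_unit : forall g x,
      x \in component g -> x != 0 -> x \is a GRing.unit
  }.

Section Support.
Variables (K : fieldType) (G : zmodType) (D : falgType K).
Variable Gamma : division_grading G D.

Definition in_support : {pred G} := [pred g | Gamma g != 0%VS].

Lemma in_supportP g :
  reflect (exists2 x, x \in Gamma g & x != 0) (g \in in_support).
Proof.
apply: (iffP idP) => [|[x xg x0]]; rewrite inE.
  by rewrite -vpick0 => ?; exists (vpick (Gamma g)); rewrite ?memv_pick.
by apply: contra x0 => /eqP g0; rewrite -memv0 -g0.
Qed.

Lemma component_decomp a : exists (s : seq G) (x : G -> D),
  [/\ uniq s, forall g, x g \in Gamma g, forall g, g \notin s -> x g = 0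
    & a = \sum_(g <- s) x g].
Proof.
have [s [x [us xG ->]]] := component_span Gamma a.
exists s, (fun g => if g \in s then x g else 0); split=> //.
- by move=> g; case: ifP => // _; rewrite mem0v.
- by move=> g /negPf ->.
- by rewrite [LHS]big_seq [RHS]big_seq; apply: eq_bigr => g ->.
Qed.

Lemma component_coef s (x : G -> D) a h : uniq s ->
  (forall g, x g \in Gamma g) -> (forall g, g \notin s -> x g = 0) ->
  \sum_(g <- s) x g = a -> a \in Gamma h -> x h = a.
Proof.
move=> us xG x0 sx ah.
have : exists s', [/\ uniq s', h \in s' & \sum_(g <- s') x g = a].
  have [hs|hs] := boolP (h \in s); first by exists s.
  by exists (h :: s); rewrite /= us hs mem_head big_cons x0 // add0r.
case=> s' [us' hs' sx'].
apply/eqP; rewrite -subr_eq0; apply/eqP.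
have := @component_indep _ _ _ Gamma s' (fun g => x g - (if g == h then a else 0)) us'.
move=> /(_ _ _ h hs'); rewrite eqxx; apply.
  by move=> g; case: eqP => [->|_]; rewrite ?subr0 // memvB.
rewrite big_split /= sx' sumrN (bigD1_seq h) //= eqxx big1 ?addr0 ?subrr //.
by move=> g /negPf ->.
Qed.

Lemma component_coef_shift s (x : G -> D) (F : {additive D -> D}) a h k :
  uniq s -> (forall g, x g \in Gamma g) -> (forall g, g \notin s -> x g = 0) ->
  (forall g y, y \in Gamma g -> F y \in Gamma (g + k)) ->
  F (\sum_(g <- s) x g) = a -> a \in Gamma h -> F (x (h - k)) = a.
Proof.
move=> us xG x0 FG Fa ah.
apply: (@component_coef [seq g + k | g <- s] (fun g => F (x (g - k))) a h) => //.
- by rewrite map_inj_uniq //; apply: addIr.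
- by move=> g; rewrite -[X in Gamma X](subrK k); apply: FG.
- move=> g gs; rewrite x0 ?raddf0 //; apply: contra gs => gs.
  by apply/mapP; exists (g - k); rewrite ?subrK.
- by rewrite big_map -Fa raddf_sum; apply: eq_bigr => g _; rewrite addrK.
Qed.

Lemma component1 : 1 \in Gamma 0.
Proof.
have [s [e [us eG e0 E]]] := component_decomp 1.
have e0x h x : x \in Gamma h -> e 0 * x = x.
  move=> xh; rewrite -[0](subrr h).
  apply: (@component_coef_shift s e (x \o* idfun) x h h) => //=.
    by move=> g y yg; apply: component_mul.
  by rewrite -E mul1r.
suff <- : e 0 = 1 by [].
rewrite -[LHS]mulr1 {1}E mulr_sumr E.
by apply: eq_bigr => g _; apply: (e0x g).
Qed.

Fact in_support_zmod_closed : zmod_closed in_support.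
Proof.
split=> [|g h /in_supportP [x xg x0] /in_supportP [y yh y0]].
  by apply/in_supportP; exists 1; rewrite ?oner_neq0 ?component1.
have ux := component_unit xg x0; have uy := component_unit yh y0.
have [s [z [us zG z0 E]]] := component_decomp y^-1.
have yz : y * z (- h) = 1.
  rewrite -[- h]add0r.
  apply: (@component_coef_shift s z (y \*o idfun) 1 0 h) => //=.
  - by move=> g' y' yg'; rewrite addrC; apply: component_mul.
  - by rewrite -E divrr.
  - exact: component1.
apply/in_supportP; exists (x * z (- h)); first exact: component_mul.
apply/eqP => /(congr1 (fun t => y * (x^-1 * t))).
by rewrite mulKr // yz !mulr0 => /eqP; rewrite oner_eq0.
Qed.

HB.instance Definition _ :=
  GRing.isZmodClosed.Build G in_support in_support_zmod_closed.

Definition supp := {g : G | g \in in_support}.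
HB.instance Definition _ := SubType.on supp.
HB.instance Definition _ := Choice.on supp.
HB.instance Definition _ := [SubChoice_isSubZmodule of supp by <:].

End Support.

Section Automorphisms.
Variables (K : fieldType) (G : zmodType) (D : falgType K).
Variable Gamma : division_grading G D.

Definition grading_aut : set 'AEnd(D) :=
  [set psi : 'AEnd(D) | bijective psi /\ forall g, exists h, (psi @: Gamma g)%VS = Gamma h].

Definition grading_stab : set 'AEnd(D) :=
  [set psi : 'AEnd(D) | bijective psi /\ forall g, (psi @: Gamma g)%VS = Gamma g].

Definition induces (psi : 'AEnd(D)) (f : supp Gamma -> supp Gamma) : Prop :=
  forall t, (psi @: Gamma (val t))%VS = Gamma (val (f t)).

(* The image of [grading_aut] in the permutations of the support; by
   [induces_ex], [induces_comp] and [induces_coset] below it is the quotient of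
   [grading_aut] by [grading_stab]. *)
Definition weyl_group : set (supp Gamma -> supp Gamma) :=
  [set f | exists2 psi, grading_aut psi & induces psi f].

Lemma component_inj (s t : supp Gamma) :
  Gamma (val s) = Gamma (val t) -> s = t.
Proof.
have /in_supportP [x xs x0] := valP s => E.
have xt : x \in Gamma (val t) by rewrite -E.
apply: val_inj; apply/eqP; apply: contraNT x0 => st; apply/eqP.
rewrite -(@component_coef _ _ _ Gamma [:: val t]
  (fun g => if g == val t then x else 0) x (val s)) //.
- by rewrite (negPf st).
- by move=> g; case: eqP => [->|_]; rewrite ?mem0v.
- by move=> g; rewrite inE => /negPf ->.
- by rewrite big_seq1 eqxx.
Qed.

Lemma bijective_lker (psi : 'AEnd(D)) : bijective psi -> lker psi == 0%VS.
Proof. by move=> /bij_inj psiI; apply/lker0P. Qed.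

Lemma induces_ex psi : grading_aut psi -> exists! f, induces psi f.
Proof.
move=> [bpsi psiG].
have ex (t : supp Gamma) : exists u : supp Gamma,
    (psi @: Gamma (val t))%VS = Gamma (val u).
  have [h E] := psiG (val t).
  have hS : h \in in_support Gamma.
    have /in_supportP [x xt x0] := valP t; apply/in_supportP; exists (psi x).
      by rewrite -E memv_img.
    by rewrite -(raddf0 psi) (inj_eq (bij_inj bpsi)).
  by exists (exist _ h hS).
have [f fP] := choice ex; exists f; split=> // f' f'P.
by apply: funext => t; apply: component_inj; rewrite -fP f'P.
Qed.

Lemma induces_comp psi psi' f f' :
  induces psi f -> induces psi' f' -> induces (psi \o psi')%AF (f \o f').
Proof. by move=> pf pf' t; rewrite /= limg_comp pf' pf. Qed.

Lemma induces_coset psi psi' f f' :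
    grading_aut psi -> grading_aut psi' -> induces psi f -> induces psi' f' ->
  f = f' <-> exists2 sigma, grading_stab sigma & psi' = (psi \o sigma)%AF.
Proof.
move=> [bpsi _] [bpsi' _] pf pf'; split=> [ff'|[sigma [_ sG] E]]; last first.
  apply: funext => t; apply: component_inj.
  by rewrite -pf -pf' E /= limg_comp sG.
have kpsi := bijective_lker bpsi; have ipsi := bij_inj bpsi.
pose s := (psi^-1 \o psi')%VF.
have sE x : psi (s x) = psi' x by rewrite /s comp_lfunE lker0_lfunVK.
have sA : ahom_in {:D} s.
  apply/ahom_inP; split=> [x y _ _|]; apply: ipsi.
    by rewrite rmorphM /= !sE rmorphM.
  by rewrite sE !rmorph1.
exists (AHom sA); last first.
  by apply/val_inj/lfunP => x; rewrite /= comp_lfunE sE.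
split.
  have [h hK Kh] := bpsi'; exists (h \o psi) => x /=.
    by rewrite sE hK.
  by apply: ipsi; rewrite sE Kh.
move=> g; rewrite /=.
have [gS|] := boolP (g \in in_support Gamma); last first.
  by rewrite inE negbK => /eqP ->; rewrite limg0.
have E : (psi' @: Gamma g = psi @: Gamma g)%VS.
  by rewrite (pf (exist _ g gS)) (pf' (exist _ g gS)) ff'.
by rewrite /s limg_comp E -limg_comp lker0_compVf // lim1g.
Qed.

End Automorphisms.

Arguments grading_aut {K G D} Gamma _.
Arguments grading_stab {K G D} Gamma _.
Arguments weyl_group {K G D} Gamma _.

Definition inner_automorphism (K : fieldType) (D : falgType K) (psi : 'AEnd(D)) :=
  exists2 d : D, d \is a GRing.unit & forall x, psi x = d * x * d^-1.

(* Isomorphism of the group A, a subset of U with product opA, with the group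
   B, a subset of V with product opB. *)
Definition isomorphic_groups (U V : Type) (A : set U) (opA : U -> U -> U)
    (B : set V) (opB : V -> V -> V) : Prop :=
  exists phi : U -> V, set_bij A B phi /\
    forall x y, A x -> A y -> phi (opA x y) = opB (phi x) (phi y).

Definition group_automorphism (T : zmodType) (f : T -> T) : Prop :=
  bijective f /\ {morph f : u v / u + v}.

Section Characters.
Variables (R : realType) (T : zmodType).

Definition character_group : set (T -> R[i]) :=
  [set chi | (forall t, chi t != 0) /\
             (forall u v, chi (u + v) = chi u * chi v)].

Definition character_mul (chi chi' : T -> R[i]) : T -> R[i] :=
  fun t => chi t * chi' t.

Definition alternating_bicharacter (beta : T -> T -> R[i]) : Prop :=
  [/\ forall u v, beta u v != 0,
      forall u v w, beta (u + v) w = beta u w * beta v w,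
      forall u v w, beta u (v + w) = beta u v * beta u w
    & forall u, beta u u = 1].

End Characters.

Arguments character_group R T _ : clear implicits.
Arguments character_mul {R T} chi chi' _ /.

Section RealAlgebras.
Variables (R : realType) (D : falgType R).

Definition complex_matrix_algebra : Prop :=
  exists (n : nat) (phi : {rmorphism D -> 'M[R[i]]_n.+1}),
    bijective phi /\ forall (a : R) x, phi (a *: x) = a%:C *: phi x.

Variables (G : zmodType) (Gamma : division_grading G D).

Definition type_2f : Prop :=
  Gamma 0 = 'Z({:D})%VS /\
  forall g, g \in in_support Gamma -> \dim (Gamma g) = 2%N.

Definition identity_component_iso (iota : {rmorphism R[i] -> D}) : Prop :=
  (forall a : R, iota a%:C = a%:A) /\
  (forall x, x \in Gamma 0 <-> exists z, iota z = x).

Definition commutation (iota : R[i] -> D)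
    (beta : supp Gamma -> supp Gamma -> R[i]) : Prop :=
  forall (u v : supp Gamma) x y, x \in Gamma (val u) -> y \in Gamma (val v) ->
    x * y = iota (beta u v) * (y * x).

End RealAlgebras.

(* Main.v *)
(* Write D_0 = C.  Each component is D_t = C X_t, and the relations
   X_u X_v = sigma(u,v) X_(u+v) have a 2-cocycle sigma with
   sigma(u,v) = beta(u,v) sigma(v,u).  A real automorphism is either linear or
   semilinear over C; if it induces f on T, it is given by scalars c_t with
   X_t |-> c_t X_(f t), and beta o f is beta or its conjugate accordingly.
   Conversely the scalars c_t exist as soon as beta o f has this property,
   because the 2-cocycle comparing sigma with sigma o f is then symmetric, and
   symmetric C^*-valued 2-cocycles on a finite abelian group are coboundaries.
   For f = id the scalars of a linear automorphism form a character of T, and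
   nondegeneracy of beta makes every character of the form beta(u,-): the
   automorphism is conjugation by X_u.  If beta is real, some semilinear
   automorphism stabilizes the grading; the moduli of its scalars form a
   positive character of the finite group T, so they are 1, which makes it an
   involution that commutes with the linear ones. *)
Require Import Defs.
From HB Require Import structures.
From mathcomp Require Import all_boot all_order all_algebra all_field.
From mathcomp Require Import boolp classical_sets functions cardinality reals.
From mathcomp Require Import complex spectral ring.
Import GRing.Theory Num.Theory.
Local Open Scope ring_scope.
Local Open Scope complex_scope.
Local Open Scope classical_set_scope.
Set Implicit Arguments.
Unset Strict Implicit.
Unset Printing Implicit Defensive.

(** * Finiteness of the support *)

Section FiniteSupport.
Variables (K : fieldType) (G : zmodType) (D : falgType K).
Variable Gamma : division_grading G D.

(** Nonzero elements taken from distinct components are linearly independent. *)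
Lemma size_uniq_supp (s : seq (supp Gamma)) : uniq s -> (size s <= \dim {:D})%N.
Proof.
move=> us.
have ex (t : supp Gamma) : exists x, x \in Gamma (val t) /\ x != 0.
  by have /in_supportP [x xt x0] := valP t; exists x.
have [X XP] := choice ex.
suff /eqP fr : free (map X s) by rewrite -(size_map X) -fr dimvS ?subvf.
rewrite -[map X s]/(tval (in_tuple (map X s))).
apply/freeP => k k0 i.
have si : (i < size s)%N by rewrite -(size_map X s).
pose t0 := nth 0 s i.
(* The terms [k j *: X t] are spread over all of [G], with value 0 off [s], to match the form of
   [component_indep]. *)
pose x g := if insub g is Some t then
  if insub (index t s) is Some j then k j *: X t else 0 else 0.
have xE j : x (val (nth 0 s (j : 'I_(size (map X s))))) = k j *: X (nth 0 s j).
  have sj : (j < size s)%N by rewrite -(size_map X s).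
  by rewrite /x valK index_uniq // valK.
have xi : x (val t0) = 0.
  apply: (@component_indep _ _ _ Gamma (map val s)).
  - by rewrite map_inj_uniq //; apply: val_inj.
  - move=> g; rewrite /x; case: insubP => [t _ <-|_]; last exact: mem0v.
    case: insubP => [j _ _|_]; last exact: mem0v.
    by apply: memvZ; have [] := XP t.
  - rewrite big_map (big_nth 0) big_mkord -[RHS]k0 /=.
    rewrite -(big_mkord xpredT (fun i => x (val (nth 0 s i)))).
    rewrite -[in LHS](size_map X s) big_mkord; apply: eq_bigr => j _.
    by rewrite xE (nth_map 0) // -(size_map X s).
  - by rewrite map_f // mem_nth.
move: xi; rewrite /t0 xE => /eqP; rewrite scaler_eq0 => /orP [/eqP //|].
by rewrite (negPf (XP _).2).
Qed.

(** Lengths of duplicate-free lists are bounded by the dimension of [D]; a list of maximal length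
    cannot be extended, so it misses nothing. *)
Lemma supp_enum_ex :
  exists s : seq (supp Gamma), uniq s /\ forall t, t \in s.
Proof.
pose P n := `[< exists2 s : seq (supp Gamma), uniq s & size s = n >].
have exP : exists n, P n by exists 0%N; apply/asboolP; exists [::].
have ubP n : P n -> (n <= \dim {:D})%N.
  by move=> /asboolP [s us <-]; apply: size_uniq_supp.
case: (ex_maxnP exP ubP) => n /asboolP [s us sn] maxn.
exists s; split=> // t; apply: contraT => ts.
have /maxn : P n.+1 by apply/asboolP; exists (t :: s); rewrite /= ?ts ?sn.
by rewrite ltnn.
Qed.

(** This chosen enumeration makes the support a finite type, able to index sums and matrices. *)
Definition supp_enum := projT1 (cid supp_enum_ex).

Lemma supp_enumK : pcancel (index^~ supp_enum)
  (fun n => if (n < size supp_enum)%N then Some (nth 0 supp_enum n) else None).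
Proof.
move=> t /=; have [_ tP] := projT2 (cid supp_enum_ex).
by rewrite index_mem tP nth_index.
Qed.

HB.instance Definition _ :=
  Countable.copy (supp Gamma) (pcan_type supp_enumK).

Lemma supp_enum_axiom : Finite.axiom supp_enum.
Proof.
move=> t; have [us tP] := projT2 (cid supp_enum_ex).
by rewrite count_uniq_mem // tP.
Qed.

HB.instance Definition _ := isFinite.Build (supp Gamma) supp_enum_axiom.
End FiniteSupport.

(** * Symmetric 2-cocycles on a finite abelian group *)

Lemma card_zmod_gt0 (T : finZmodType) : (0 < #|T|)%N.
Proof. by apply/card_gt0P; exists 0. Qed.

(* The commuting operators of the twisted regular representation attached to
   [tau] have a common eigenvector, whose eigenvalues trivialize [tau]. *)
Lemma symmetric_cocycle_coboundary (C : numClosedFieldType) (T : finZmodType)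
    (tau : T -> T -> C) :
    (forall u v, tau u v != 0) -> (forall u v, tau u v = tau v u) ->
    (forall u v w, tau u v * tau (u + v) w = tau v w * tau u (v + w)) ->
  exists c : T -> C, (forall u, c u != 0) /\
    forall u v, c u * c v = tau u v * c (u + v).
Proof.
move=> tau0 tauC tauA.
pose L u : 'M[C]_#|T| :=
  \matrix_(i, j)
    (if enum_val j == u + enum_val i then tau u (enum_val i) else 0).
have LM u v : L v *m L u = tau u v *: L (u + v).
  apply/matrixP => i j; rewrite !mxE.
  rewrite (bigD1 (enum_rank (v + enum_val i))) //= !mxE enum_rankK eqxx addrA.
  rewrite big1 ?addr0; last first.
    move=> k ki; rewrite !mxE ifN ?mul0r //; apply: contra ki => /eqP <-.
    by rewrite enum_valK.
  by case: eqP => _; rewrite ?mulr0 // mulrC -tauA mulrC.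
have [|v v0 /allP vL] :=
  @common_eigenvector C _ (map L (enum T)) (card_zmod_gt0 T).
  move=> _ _ /mapP [u _ ->] /mapP [w _ ->].
  by rewrite /comm_mx LM [in RHS]LM tauC addrC.
have ex u : exists a, v *m L u = a *: v.
  by apply/sub_rVP/vL/map_f; rewrite mem_enum.
have [c cP] := choice ex.
have cM u w : c u * c w = tau u w * c (u + w).
  apply/eqP; rewrite -subr_eq0.
  suff : (c u * c w - tau u w * c (u + w)) *: v == 0.
    by rewrite scaler_eq0 (negPf v0) orbF.
  rewrite scalerBl mulrC -!scalerA -!cP scalemxAl -cP -mulmxA LM.
  by rewrite -scalemxAr subrr.
(* As [c u * c (- u)] is [tau u (- u) * c 0], it suffices that [c 0] is nonzero. This holds because
   [L 0] is the nonzero scalar matrix [tau 0 0]. *)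
exists c; split=> // u; apply: contra_eq_neq (cM u (- u)) => ->.
rewrite mul0r subrr eq_sym mulf_neq0 //; apply: contra_neq v0 => c00.
have tau0E w : tau 0 w = tau 0 0.
  by have := tauA 0 0 w; rewrite !add0r => /(mulIf (tau0 0 w)).
have L0 : L 0 = (tau 0 0)%:M.
  apply/matrixP => i j; rewrite !mxE add0r tau0E (inj_eq enum_val_inj) eq_sym.
  by case: eqP.
have := cP 0; rewrite L0 mul_mx_scalar c00 scale0r => /eqP.
by rewrite scaler_eq0 (negPf (tau0 0 0)) => /eqP.
Qed.

(** * Characters of a finite abelian group and nondegenerate bicharacters *)

Section Characters.
Variables (R : realType) (T : finZmodType).
Implicit Types chi : T -> R[i].

Lemma char0 chi : character_group R T chi -> chi 0 = 1.
Proof.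
case=> chi0 chiM; apply: (mulfI (chi0 0)).
by rewrite -chiM addr0 mulr1.
Qed.

(** Translation by [u] permutes the factors of the product of all values of [chi], and multiplies
    that product by [chi u ^+ #|T|]. *)
Lemma char_expn chi u : character_group R T chi -> chi u ^+ #|T| = 1.
Proof.
case=> chi0 chiM; have P0 : \prod_t chi t != 0 by apply/prodf_neq0.
apply: (mulIf P0); rewrite mul1r [RHS](reindex_inj (addrI u)) /=.
by under [RHS]eq_bigr do rewrite chiM; rewrite big_split /= prodr_const.
Qed.

Lemma char_nonneg chi u : character_group R T chi -> 0 <= chi u -> chi u = 1.
Proof.
move=> chiP chiu; apply/eqP.
have := char_expn u chiP => /eqP; rewrite pexprn_eq1 //.
by rewrite -leqn0 leqNgt card_zmod_gt0.
Qed.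

(** Translation by [u] fixes the sum and also multiplies it by [chi u]. *)
Lemma char_sum0 chi u : character_group R T chi -> chi u != 1 ->
  \sum_t chi t = 0.
Proof.
case=> chi0 chiM u1; have E : \sum_t chi t = chi u * \sum_t chi t.
  by rewrite mulr_sumr [LHS](reindex_inj (addrI u)); apply: eq_bigr.
have /eqP : (chi u - 1) * \sum_t chi t = 0 by rewrite mulrBl mul1r -E subrr.
by rewrite mulf_eq0 subr_eq0 (negPf u1) => /eqP.
Qed.

Section Duality.
Variable beta : T -> T -> R[i].
Hypothesis betaP : alternating_bicharacter beta.
Hypothesis beta_nondeg : forall u, (forall v, beta u v = 1) -> u = 0.

Lemma bicharC u v : beta v u = (beta u v)^-1.
Proof.
have [b0 bl br b1] := betaP; apply: (mulfI (b0 u v)); rewrite mulfV //.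
by have := b1 (u + v); rewrite bl !br !b1 mul1r mulr1.
Qed.

Lemma bichar_inj u v : (forall w, beta u w = beta v w) -> u = v.
Proof.
have [b0 bl br b1] := betaP => uv; apply/subr0_eq/beta_nondeg => w.
by apply: (mulIf (b0 v w)); rewrite -bl subrK mul1r.
Qed.

(* Otherwise the sum over [u] and [t] of [chi t * beta t u] is [0] when summed
   first over [t], but [#|T|] when summed first over [u]. *)
Lemma bichar_surj chi : character_group R T chi ->
  exists u, forall t, beta u t = chi t.
Proof.
have [b0 bl br b1] := betaP => chiP; have [chi0 chiM] := chiP.
apply: contrapT => nex.
have S0 : \sum_u \sum_t chi t * beta t u = 0.
  apply: big1 => u _.
  have /existsNP [t tu] : ~ forall t, beta u t = chi t.
    by move=> ut; apply: nex; exists u.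
  apply: (@char_sum0 (fun t => chi t * beta t u) t).
    by split=> [v|v w]; rewrite ?mulf_neq0 // chiM bl mulrACA.
  apply: contra_not_neq tu => E; apply: (mulIf (b0 t u)).
  by rewrite E bicharC mulVf.
have : \sum_u \sum_t chi t * beta t u = #|T|%:R.
  rewrite exchange_big /= (bigD1 0) //= [X in _ + X]big1 ?addr0 => [|t t0].
    rewrite -[RHS]sumr_const; apply: eq_bigr => u _.
    rewrite char0 // mul1r; apply: (mulfI (b0 0 u)).
    by rewrite -bl addr0 mulr1.
  rewrite -mulr_sumr; apply/eqP; rewrite mulf_eq0 (negPf (chi0 t)) /=.
  have /existsNP [v /eqP tv] : ~ forall v, beta t v = 1.
    by move/beta_nondeg/eqP; rewrite (negPf t0).
  by rewrite (@char_sum0 _ v).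
by rewrite S0 => /esym/eqP; rewrite pnatr_eq0 -leqn0 leqNgt card_zmod_gt0.
Qed.

End Duality.
End Characters.

Lemma component_degree_inj (K : fieldType) (G : zmodType) (D : falgType K)
    (Gamma : division_grading G D) x g h :
  x \in Gamma g -> x \in Gamma h -> x != 0 -> g = h.
Proof.
move=> xg xh x0.
have gS : g \in in_support Gamma by apply/in_supportP; exists x.
have hS : h \in in_support Gamma by apply/in_supportP; exists x.
apply/eqP; apply: contraNT x0 => gh; apply/eqP.
rewrite -(@component_coef _ _ _ Gamma [:: g]
  (fun k => if k == g then x else 0) x h) //.
- by rewrite eq_sym (negPf gh).
- by move=> k; case: eqP => [->|_]; rewrite ?mem0v.
- by move=> k; rewrite inE => /negPf ->.
- by rewrite big_seq1 eqxx.
Qed.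

(** * The graded algebra as a twisted group algebra over the complex numbers *)

Section TwistedGroupAlgebra.
Variables (R : realType) (G : zmodType) (D : falgType R).
Variable Gamma : division_grading G D.
Hypothesis Gamma_2f : type_2f Gamma.
Variable iota : {rmorphism R[i] -> D}.
Hypothesis iotaP : identity_component_iso Gamma iota.
Variable beta : supp Gamma -> supp Gamma -> R[i].
Hypothesis betaP : alternating_bicharacter beta.
Hypothesis betaC : commutation iota beta.

Local Notation T := (supp Gamma).
Implicit Types (t u v w : T) (z : R[i]) (x y : D) (b : bool) (psi : 'AEnd(D)).

(** The Boolean lets linear ([false]) and semilinear ([true]) automorphisms be treated by the same
    formulas. *)
Definition conj_if b : {rmorphism R[i] -> R[i]} :=
  if b then (@conjc R : {rmorphism R[i] -> R[i]}) else idfun.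

Lemma conj_if_real b (a : R) : conj_if b a%:C = a%:C.
Proof. by case: b; [apply: conjc_real|]. Qed.

Lemma in_center x : reflect (forall y, x * y = y * x) (x \in Gamma 0).
Proof.
rewrite Gamma_2f.1 /center_vspace memv_cap memvf /=.
by apply: (iffP centvP) => [xC y|xC y _]; rewrite ?xC ?memvf.
Qed.

Lemma iota_component z : iota z \in Gamma 0.
Proof. by apply/iotaP.2; exists z. Qed.

Lemma iotaC z x : iota z * x = x * iota z.
Proof. by have /in_center := iota_component z; apply. Qed.

Lemma iota_scale (a : R) x : a *: x = iota a%:C * x.
Proof. by rewrite iotaP.1 mulr_algl. Qed.

Definition gen t : D := vpick (Gamma (val t)).

Lemma gen_component t : gen t \in Gamma (val t).
Proof. exact: memv_pick. Qed.

Lemma gen_neq0 t : gen t != 0.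
Proof. by rewrite vpick0; have := valP t. Qed.

Lemma gen_unit t : gen t \is a GRing.unit.
Proof. by rewrite (component_unit (gen_component t)) ?gen_neq0. Qed.

Lemma iota_gen_component z t : iota z * gen t \in Gamma (val t).
Proof.
by rewrite -[val t]add0r component_mul ?iota_component ?gen_component.
Qed.

Lemma iota_genI t : injective (fun z => iota z * gen t).
Proof. by move=> z z' /(mulIr (gen_unit t)) /fmorph_inj. Qed.

Lemma iota_gen_neq0 z t : z != 0 -> iota z * gen t != 0.
Proof.
apply: contra_neq => E; apply: (@iota_genI t).
by rewrite E rmorph0 mul0r.
Qed.

(** Right multiplication by the unit [gen (- t)] carries both [y] and [gen t] into the identity
    component, a copy of the complex numbers, where they can be divided. *)
Lemma component_iota_gen t y :
  y \in Gamma (val t) -> exists z, y = iota z * gen t.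
Proof.
move=> yt; have c0 x : x \in Gamma (val t) -> x * gen (- t) \in Gamma 0.
  by move=> xt; rewrite -(subrr (val t)) component_mul // (gen_component (- t)).
have /iotaP.2 [a aE] := c0 y yt.
have /iotaP.2 [z zE] := c0 _ (gen_component t).
have z0 : z != 0.
  apply: contra_neq (gen_neq0 t) => z0; apply: (mulIr (gen_unit (- t))).
  by rewrite -zE z0 rmorph0 mul0r.
exists (a / z); apply: (mulIr (gen_unit (- t))).
by rewrite -aE -mulrA -zE -rmorphM divfK.
Qed.

Lemma gen_cocycle_ex : exists sigma : T -> T -> R[i],
  forall u v, gen u * gen v = iota (sigma u v) * gen (u + v).
Proof.
have ex (p : T * T) :
    exists z, gen p.1 * gen p.2 = iota z * gen (p.1 + p.2).
  by apply/component_iota_gen/component_mul; apply: gen_component.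
have [s sP] := choice ex.
by exists (fun u v => s (u, v)) => u v; apply: (sP (u, v)).
Qed.

Definition sigma := projT1 (cid gen_cocycle_ex).

Lemma genM u v : gen u * gen v = iota (sigma u v) * gen (u + v).
Proof. exact: (projT2 (cid gen_cocycle_ex)). Qed.

Lemma iota_genM z z' u v : iota z * gen u * (iota z' * gen v) =
  iota (z * z' * sigma u v) * gen (u + v).
Proof.
rewrite !rmorphM -!mulrA -genM !mulrA -[_ * gen u * _]mulrA.
by rewrite -[gen u * _]iotaC mulrA.
Qed.

Lemma sigma_neq0 u v : sigma u v != 0.
Proof.
apply: contra_neq (gen_neq0 v) => E; apply: (mulrI (gen_unit u)).
by rewrite genM E rmorph0 mul0r mulr0.
Qed.

Lemma sigmaC u v : sigma u v = beta u v * sigma v u.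
Proof.
apply: (@iota_genI (u + v)) => /=; rewrite -genM rmorphM -mulrA.
by rewrite [u + v]addrC -genM; apply: betaC; apply: gen_component.
Qed.

Lemma sigmaA u v w :
  sigma u v * sigma (u + v) w = sigma v w * sigma u (v + w).
Proof.
apply: (@iota_genI (u + v + w)); rewrite /= !rmorphM -!mulrA -genM.
rewrite mulrA -genM -addrA -genM mulrA iotaC -[RHS]mulrA -genM.
by rewrite mulrA.
Qed.

Lemma coord_ex x : exists z : T -> R[i], x = \sum_t iota (z t) * gen t.
Proof.
have [s [y [_ yG ->]]] := component_span Gamma x.
elim/big_ind: _ => [|_ _ [z ->] [z' ->]|g _].
- by exists (fun=> 0); rewrite big1 // => t _; rewrite rmorph0 mul0r.
- exists (fun t => z t + z' t); rewrite -big_split; apply: eq_bigr => t _.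
  by rewrite rmorphD mulrDl.
have [->|y0] := eqVneq (y g) 0.
  by exists (fun=> 0); rewrite big1 // => t _; rewrite rmorph0 mul0r.
have gS : g \in in_support Gamma by apply/in_supportP; exists (y g).
pose t : T := exist _ g gS; have [z zE] := @component_iota_gen t _ (yG g).
exists (fun u => if u == t then z else 0).
rewrite (bigD1 t) //= eqxx big1 ?addr0 // => u /negPf ->.
by rewrite rmorph0 mul0r.
Qed.

Definition coord x : T -> R[i] := projT1 (cid (coord_ex x)).

Lemma coordP x : x = \sum_t iota (coord x t) * gen t.
Proof. exact: (projT2 (cid (coord_ex x))). Qed.

Lemma gen_indep (z : T -> R[i]) :
  \sum_t iota (z t) * gen t = 0 -> forall t, z t = 0.
Proof.
move=> z0 t; apply: (@iota_genI t); rewrite /= rmorph0 mul0r.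
(* The family is extended by 0 from the support to [G]. *)
pose x g := if insub g is Some t then iota (z t) * gen t else 0.
have xE u : x (val u) = iota (z u) * gen u by rewrite /x valK.
rewrite -xE; apply: (@component_indep _ _ _ Gamma (map val (enum {: T}))).
- by rewrite map_inj_uniq ?enum_uniq //; apply: val_inj.
- move=> g; rewrite /x; case: insubP => [u _ <-|_]; last exact: mem0v.
  exact: iota_gen_component.
- by rewrite big_map -[RHS]z0 big_enum; apply: eq_bigr => u _; apply: xE.
- by rewrite map_f // mem_enum.
Qed.

Lemma coord_uniq (z : T -> R[i]) t :
  coord (\sum_t iota (z t) * gen t) t = z t.
Proof.
apply/eqP; rewrite -subr_eq0; apply/eqP; move: t.
apply: (@gen_indep (fun t => _ - _)).
under eq_bigr do rewrite rmorphB mulrBl.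
by rewrite sumrB -coordP subrr.
Qed.

Lemma coordD x y t : coord (x + y) t = coord x t + coord y t.
Proof.
rewrite -(coord_uniq (fun t => coord x t + coord y t)); congr (coord _ t).
by under eq_bigr do rewrite rmorphD mulrDl; rewrite big_split -!coordP.
Qed.

Lemma coord_iota z x t : coord (iota z * x) t = z * coord x t.
Proof.
rewrite -(coord_uniq (fun t => z * coord x t)); congr (coord _ t).
by under eq_bigr do rewrite rmorphM -mulrA; rewrite -mulr_sumr -coordP.
Qed.

Lemma coord_iota_gen z t u :
  coord (iota z * gen t) u = if u == t then z else 0.
Proof.
rewrite -(coord_uniq (fun u => if u == t then z else 0)); congr (coord _ u).
rewrite (bigD1 t) //= eqxx big1 ?addr0 // => v /negPf ->.
by rewrite rmorph0 mul0r.
Qed.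

Lemma AEnd_eq psi psi' :
  (forall z t, psi (iota z * gen t) = psi' (iota z * gen t)) -> psi = psi'.
Proof.
move=> E; apply/val_inj/lfunP => x /=.
by rewrite (coordP x) !linear_sum; apply: eq_bigr => t _; apply: E.
Qed.

(** * Automorphisms built from scalars *)

Section Construction.
Variables (b : bool) (f : T -> T) (c : T -> R[i]).
Hypotheses (f_inj : injective f) (fD : {morph f : u v / u + v}).
Hypothesis c_neq0 : forall t, c t != 0.
Hypothesis cM : forall u v,
  c u * c v * sigma (f u) (f v) = conj_if b (sigma u v) * c (u + v).

Let F x := \sum_t iota (conj_if b (coord x t) * c t) * gen (f t).

Let F_linear : linear F.
Proof.
move=> a x y; rewrite /F [in LHS]iota_scale [in RHS]iota_scale.
rewrite mulr_sumr -big_split; apply: eq_bigr => t _.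
rewrite coordD coord_iota rmorphD [conj_if b (_ * _)]rmorphM conj_if_real.
by rewrite mulrDl -mulrA rmorphD [iota (_%:C * _)]rmorphM mulrDl mulrA.
Qed.

Let L : {linear D -> D} := HB.pack F (GRing.isLinear.Build R D D _ F F_linear).

Let FE z t : L (iota z * gen t) = iota (conj_if b z * c t) * gen (f t).
Proof.
rewrite /= /F (bigD1 t) //= coord_iota_gen eqxx big1 ?addr0 // => u ut.
by rewrite coord_iota_gen (negPf ut) rmorph0 mul0r rmorph0 mul0r.
Qed.

Let LM : {morph L : x y / x * y}.
Proof.
move=> x y; rewrite (coordP x) (coordP y) mulr_suml !linear_sum mulr_suml.
apply: eq_bigr => u _; rewrite !mulr_sumr linear_sum; apply: eq_bigr => v _.
rewrite iota_genM !FE iota_genM fD; congr (iota _ * _).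
by rewrite 2!rmorphM -mulrA -cM !mulrA; do 2!congr (_ * _); rewrite mulrAC.
Qed.

Let L_inj : injective L.
Proof.
have [g fK gK] := injF_bij f_inj.
apply: raddf_inj => x; rewrite /= /F.
have -> : \sum_t iota (conj_if b (coord x t) * c t) * gen (f t) =
    \sum_s iota (conj_if b (coord x (g s)) * c (g s)) * gen s.
  by rewrite [RHS](reindex_inj f_inj); apply: eq_bigr => t _; rewrite fK.
move/gen_indep => x0; rewrite (coordP x) big1 // => t _.
have /eqP := x0 (f t); rewrite fK mulf_eq0 (negPf (c_neq0 t)) orbF fmorph_eq0.
by move/eqP ->; rewrite rmorph0 mul0r.
Qed.

Lemma semilinear_aut : exists psi, bijective psi /\
  forall z t, psi (iota z * gen t) = iota (conj_if b z * c t) * gen (f t).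
Proof.
have f0 : f 0 = 0 by apply: (addrI (f 0)); rewrite -fD !addr0.
(* Since [gen 0] need not be 1, this is not immediate: [L 1] is idempotent, and it is invertible
   because it is homogeneous and nonzero. *)
have L1 : L 1 = 1.
  have [z zE] := @component_iota_gen 0 _ (component1 Gamma).
  have u1 : L 1 \is a GRing.unit.
    have h : L 1 \in Gamma (val (0 : T)).
      by rewrite zE FE f0 iota_gen_component.
    by rewrite (component_unit h) // raddf_eq0 ?oner_neq0.
  by apply: (mulrI u1); rewrite -LM !mulr1.
have LA : ahom_in {:D} (linfun L).
  by apply/ahom_inP; split=> [x y _ _|]; rewrite !lfunE //; apply: LM.
exists (AHom LA); split=> [|z t]; last by rewrite -FE -[RHS]lfunE.
have kL : lker (linfun L) == 0%VS.
  by apply/lker0P => x y; rewrite !lfunE => /L_inj.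
exists ((linfun L)^-1)%VF; [exact: lker0_lfunK | exact: lker0_lfunVK].
Qed.

End Construction.

Lemma twist_ex b (f : T -> T) : {morph f : u v / u + v} ->
    (forall u v, beta (f u) (f v) = conj_if b (beta u v)) ->
  exists c : T -> R[i], (forall t, c t != 0) /\
    forall u v,
      c u * c v * sigma (f u) (f v) = conj_if b (sigma u v) * c (u + v).
Proof.
move=> fD fbeta; have [b0 _ _ _] := betaP.
pose tau u v := conj_if b (sigma u v) / sigma (f u) (f v).
have tauE u v : tau u v * sigma (f u) (f v) = conj_if b (sigma u v).
  by rewrite divfK ?sigma_neq0.
have [|||c [c0 cM]] := @symmetric_cocycle_coboundary R[i] T tau.
- by move=> u v; rewrite mulf_neq0 ?invr_eq0 ?fmorph_eq0 ?sigma_neq0.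
(* Exchanging [u] and [v] changes numerator and denominator of [tau] by the factors
   [conj_if b (beta u v)] and [beta (f u) (f v)], which agree. *)
- move=> u v; rewrite /tau sigmaC [in X in _ / X]sigmaC fbeta.
  by rewrite rmorphM invfM mulrACA mulfV ?mul1r // fmorph_eq0.
- by move=> u v w; rewrite /tau !mulf_div -!rmorphM !fD !sigmaA.
by exists c; split=> // u v; rewrite cM mulrAC tauE.
Qed.

(** * The scalars of a given automorphism *)

Definition conj_flag psi := psi (iota 'i%C) != iota 'i%C.

(** An automorphism preserves the center and fixes the real scalars; it sends i to a central square
    root of -1, that is, to i or -i. *)
Lemma aut_iota psi z :
  bijective psi -> psi (iota z) = iota (conj_if (conj_flag psi) z).
Proof.
move=> [psi' psiK psi'K].
have /iotaP.2 [j jE] : psi (iota 'i%C) \in Gamma 0.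
  by apply/in_center => y; rewrite -[y]psi'K -!rmorphM iotaC.
have j2 : j ^+ 2 = - 1.
  apply: (fmorph_inj iota); rewrite rmorphXn jE -!rmorphXn sqr_i.
  by rewrite !rmorphN !rmorph1.
have jP : j = conj_if (conj_flag psi) 'i%C.
  have /eqP : (j - 'i%C) * (j + 'i%C) = 0.
    by rewrite -subr_sqr j2 sqr_i subrr.
  rewrite /conj_flag -jE (inj_eq (fmorph_inj iota)) mulf_eq0 subr_eq0 addr_eq0.
  case: eqP => [-> //|_] /= /eqP ->.
  by apply/eqP; rewrite eq_complex /= oppr0 !eqxx.
have real (a : R) : psi (iota a%:C) = iota a%:C.
  by rewrite iotaP.1 linearZ rmorph1.
have E b : iota (conj_if b z) =
    iota (complex.Re z)%:C + iota (conj_if b 'i%C) * iota (complex.Im z)%:C.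
  rewrite -rmorphM -rmorphD; congr (iota _).
  rewrite -{1}(conj_if_real b (complex.Re z)) -(conj_if_real b (complex.Im z)).
  by rewrite -rmorphM -rmorphD -complexE.
rewrite -[iota z]/(iota (conj_if false z)) E rmorphD rmorphM /=.
by rewrite !real -jE jP -E.
Qed.

Section InducedMap.
Variables (psi : 'AEnd(D)) (f : T -> T).
Hypotheses (psiG : grading_aut Gamma psi) (psif : induces psi f).

Definition coef t := coord (psi (gen t)) (f t).

Lemma aut_gen z t :
  psi (iota z * gen t) = iota (conj_if (conj_flag psi) z * coef t) * gen (f t).
Proof.
have /component_iota_gen [w wE] : psi (gen t) \in Gamma (val (f t)).
  by rewrite -psif memv_img // gen_component.
rewrite rmorphM /= aut_iota; last exact: psiG.1.
by rewrite rmorphM -mulrA /coef wE coord_iota_gen eqxx.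
Qed.

Lemma aut_gen1 t : psi (gen t) = iota (coef t) * gen (f t).
Proof. by rewrite -[gen t]mul1r -(rmorph1 iota) aut_gen rmorph1 mul1r. Qed.

Lemma coef_neq0 t : coef t != 0.
Proof.
have : psi (gen t) != 0.
  by rewrite raddf_eq0 ?gen_neq0 //; apply: bij_inj; apply: psiG.1.
by apply: contra_neq => E; rewrite aut_gen1 E rmorph0 mul0r.
Qed.

(** The nonzero element [psi (gen u) * psi (gen v)] has degree [f u + f v] as a product and
    [f (u + v)] as an image, and its degree is unique. *)
Lemma induced_morph : {morph f : u v / u + v}.
Proof.
move=> u v; apply: val_inj.
have uvE : psi (gen u) * psi (gen v) = psi (iota (sigma u v) * gen (u + v)).
  by rewrite -genM rmorphM.
apply: (@component_degree_inj _ _ _ Gamma (psi (gen u) * psi (gen v))).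
- by rewrite uvE aut_gen iota_gen_component.
- by rewrite component_mul // aut_gen1 iota_gen_component.
rewrite uvE aut_gen iota_gen_neq0 // mulf_neq0 ?coef_neq0 //.
by rewrite fmorph_eq0 sigma_neq0.
Qed.

(** Applying [psi] to [genM] shows that the relation assumed in the construction of automorphisms is
    also necessary. *)
Lemma coefM u v : coef u * coef v * sigma (f u) (f v) =
  conj_if (conj_flag psi) (sigma u v) * coef (u + v).
Proof.
apply: (@iota_genI (f (u + v))); rewrite /= -aut_gen -genM [RHS]rmorphM /=.
by rewrite !aut_gen1 iota_genM induced_morph.
Qed.

(** The relation [coefM] for [(u, v)] is compared with the one for [(v, u)]; the scalars of [psi]
    cancel. *)
Lemma induced_beta u v :
  beta (f u) (f v) = conj_if (conj_flag psi) (beta u v).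
Proof.
apply: (mulIf (sigma_neq0 (f v) (f u))); rewrite -sigmaC.
apply: (mulfI (mulf_neq0 (coef_neq0 u) (coef_neq0 v))).
rewrite coefM [in LHS]sigmaC rmorphM addrC -mulrA -coefM [RHS]mulrCA.
by rewrite [coef v * _]mulrC.
Qed.

Lemma induced_inj : injective f.
Proof.
have sub u v : f u = f v -> (Gamma (val u) <= Gamma (val v))%VS.
  by move=> fuv; rewrite -(limg_ker0 _ _ (bijective_lker psiG.1)) !psif fuv.
move=> u v fuv; apply: (@component_inj _ _ _ Gamma).
by apply/eqP; rewrite eqEsubv !sub.
Qed.

End InducedMap.

(** For such [u], [gen u] commutes with every component, so it lies in the center, which is the
    component of degree 0. *)
Lemma beta_nondeg u : (forall v, beta u v = 1) -> u = 0.
Proof.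
move=> u1; apply: val_inj.
apply: (component_degree_inj (gen_component u)) (gen_neq0 u).
apply/in_center => y; rewrite (coordP y) mulr_sumr mulr_suml.
apply: eq_bigr => v _; rewrite mulrA -iotaC -!mulrA; congr (_ * _).
by rewrite (betaC (gen_component u) (gen_component v)) u1 rmorph1 mul1r.
Qed.

(** * The Weyl group *)

Lemma gen_aut_grading psi b (f : T -> T) (c : T -> R[i]) :
    bijective psi -> (forall t, c t != 0) ->
    (forall z t, psi (iota z * gen t) = iota (conj_if b z * c t) * gen (f t)) ->
  grading_aut Gamma psi /\ induces psi f.
Proof.
move=> bpsi c0 psiE.
have psif : induces psi f.
  move=> t; apply/eqP; rewrite eqEdim; apply/andP; split.
    apply/subvP => _ /memv_imgP [x xt ->].
    by have [z ->] := component_iota_gen xt; rewrite psiE iota_gen_component.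
  (* The inclusion is an equality because [psi] is injective and both components have real dimension
     2. *)
  have [_ dim2] := Gamma_2f; rewrite limg_dim_eq.
    by rewrite !dim2 ?(valP t) ?(valP (f t)).
  by rewrite (eqP (bijective_lker bpsi)) capv0.
split=> //; split=> // g.
have [gS|] := boolP (g \in in_support Gamma).
  by exists (val (f (exist _ g gS))); rewrite -psif.
by rewrite inE negbK => /eqP g0; exists g; rewrite g0 limg0.
Qed.

Lemma weyl_groupE : weyl_group Gamma =
  [set f : T -> T | group_automorphism f /\
    ((forall u v, beta (f u) (f v) = beta u v) \/
     (forall u v, beta (f u) (f v) = (beta u v)^*%C))].
Proof.
apply/seteqP; split=> [f [psi psiG psif]|f [[fbij fD] fbeta]] /=.
  split.
    split; first exact: injF_bij (induced_inj psiG psif).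
    exact: induced_morph psiG psif.
  have := induced_beta psiG psif.
  by case: conj_flag => E; [right|left].
have [b bP] : exists b, forall u v, beta (f u) (f v) = conj_if b (beta u v).
  by case: fbeta => ?; [exists false|exists true].
have [c [c0 cM]] := twist_ex fD bP.
have [psi [bpsi psiE]] := semilinear_aut (bij_inj fbij) fD c0 cM.
by have [] := gen_aut_grading bpsi c0 psiE; exists psi.
Qed.

(** * The stabilizer in terms of flags and scalars *)

Section Stabilizer.

Lemma stab_aut psi : grading_stab Gamma psi -> grading_aut Gamma psi.
Proof. by move=> [bpsi psiG]; split=> // g; exists g. Qed.

Lemma stab_induces psi :
  grading_stab Gamma psi -> induces (Gamma := Gamma) psi id.
Proof. by move=> [_ psiG] t; apply: psiG. Qed.

Notation scoef psi := (coef psi id).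

Lemma stab_gen psi z t : grading_stab Gamma psi ->
  psi (iota z * gen t) = iota (conj_if (conj_flag psi) z * scoef psi t) * gen t.
Proof.
by move=> psiG; apply: aut_gen; [apply: stab_aut|apply: stab_induces].
Qed.

Lemma stab_coefM psi u v : grading_stab Gamma psi ->
  scoef psi u * scoef psi v * sigma u v =
  conj_if (conj_flag psi) (sigma u v) * scoef psi (u + v).
Proof.
by move=> psiG; apply: (@coefM _ id); [apply: stab_aut|apply: stab_induces].
Qed.

Lemma stab_coef_neq0 psi t : grading_stab Gamma psi -> scoef psi t != 0.
Proof.
by move=> psiG; apply: coef_neq0; [apply: stab_aut|apply: stab_induces].
Qed.

Lemma conj_if_i_inj : injective (conj_if^~ 'i%C).
Proof.
have i0 : 'i%C^*%C <> 'i%C :> R[i].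
  by move=> [/eqP]; rewrite eqNr oner_eq0.
by move=> [] [] // /esym.
Qed.

Lemma stab_coefE psi b (c : T -> R[i]) : grading_stab Gamma psi ->
    (forall z t, psi (iota z * gen t) = iota (conj_if b z * c t) * gen t) ->
  conj_flag psi = b /\ scoef psi = c.
Proof.
move=> psiG psiE.
have E z t : conj_if (conj_flag psi) z * scoef psi t = conj_if b z * c t.
  by apply: (@iota_genI t); rewrite /= -psiE stab_gen.
have E1 t : scoef psi t = c t by have := E 1 t; rewrite !rmorph1 !mul1r.
split; last exact: funext.
have := E 'i%C 0; rewrite -E1 => /(mulIf (stab_coef_neq0 0 psiG)).
exact: conj_if_i_inj.
Qed.

(** Together with [stab_eq], this parametrizes the stabilizer by the pairs [(b, c)] subject to the
    cocycle relation. *)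
Lemma stab_ex b (c : T -> R[i]) : (forall t, c t != 0) ->
    (forall u v, c u * c v * sigma u v = conj_if b (sigma u v) * c (u + v)) ->
  exists2 psi, grading_stab Gamma psi & conj_flag psi = b /\ scoef psi = c.
Proof.
move=> c0 cM; have [psi [bpsi psiE]] :=
  @semilinear_aut b id c (@inj_id T) (fun _ _ => erefl) c0 cM.
have [psiG psif] := gen_aut_grading bpsi c0 psiE.
have psiS : grading_stab Gamma psi.
  split=> // g; have [gS|] := boolP (g \in in_support Gamma).
    exact: (psif (exist _ g gS)).
  by rewrite inE negbK => /eqP ->; rewrite limg0.
by exists psi => //; apply: stab_coefE.
Qed.

Lemma stab_eq psi psi' : grading_stab Gamma psi -> grading_stab Gamma psi' ->
  conj_flag psi = conj_flag psi' -> scoef psi =1 scoef psi' -> psi = psi'.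
Proof.
move=> psiG psiG' fE cE; apply: AEnd_eq => z t.
by rewrite !stab_gen // fE cE.
Qed.

(** In these parameters the group law is twisted: a semilinear [psi] conjugates the scalars of
    [psi']. *)
Lemma stab_comp psi psi' : grading_stab Gamma psi -> grading_stab Gamma psi' ->
  [/\ grading_stab Gamma (psi \o psi')%AF,
      conj_flag (psi \o psi')%AF = conj_flag psi (+) conj_flag psi'
    & forall t, scoef (psi \o psi')%AF t =
        conj_if (conj_flag psi) (scoef psi' t) * scoef psi t].
Proof.
move=> psiG psiG'.
have compG : grading_stab Gamma (psi \o psi')%AF.
  split=> [|g]; last by rewrite /= limg_comp psiG'.2 psiG.2.
  have [h hK Kh] := psiG.1; have [h' hK' Kh'] := psiG'.1.
  by exists (h' \o h) => x; rewrite /= comp_lfunE ?hK ?hK' ?Kh' ?Kh.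
have [|-> ->] := @stab_coefE _ (conj_flag psi (+) conj_flag psi')
  (fun t => conj_if (conj_flag psi) (scoef psi' t) * scoef psi t) compG.
  move=> z t; rewrite /= comp_lfunE stab_gen // stab_gen // rmorphM -mulrA.
  congr (iota (_ * _) * _).
  by case: (conj_flag psi); case: (conj_flag psi') => //=; rewrite conjcK.
by [].
Qed.

Lemma stab_coef_character psi : grading_stab Gamma psi ->
  conj_flag psi = false -> character_group R T (scoef psi).
Proof.
move=> psiG fE; split=> [t|u v]; first exact: stab_coef_neq0.
apply: (mulIf (sigma_neq0 u v)).
by rewrite (stab_coefM u v psiG) fE mulrC.
Qed.

Lemma stab_character_ex chi : character_group R T chi ->
  exists2 psi, grading_stab Gamma psi &
    conj_flag psi = false /\ scoef psi = chi.
Proof.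
move=> [chi0 chiM]; apply: stab_ex => // u v.
by rewrite -chiM mulrC.
Qed.

Lemma character_ex chi : character_group R T chi ->
  exists u, forall t, beta u t = chi t.
Proof. exact: bichar_surj betaP beta_nondeg chi. Qed.

Lemma beta_character u : character_group R T (beta u).
Proof. by have [b0 _ br _] := betaP; split. Qed.

(** The isomorphism is the inverse of [u |-> beta u], injective by nondegeneracy and surjective by
    [character_ex]. *)
Lemma character_supp_iso :
  isomorphic_groups (character_group R T) character_mul [set: T] +%R.
Proof.
(* Functions that are not characters get the default value 0, so that choice yields a total map. *)
have ex chi : exists u, character_group R T chi -> forall t, beta u t = chi t.
  have [/character_ex [u uP]|] := pselect (character_group R T chi).
    by exists u.
  by exists 0.
have [phi phiP] := choice ex; exists phi; split.
  split=> // [chi chi' /set_mem chiG /set_mem chiG' E|u _].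
    by apply: funext => t; rewrite -phiP // E phiP.
  exists (beta u); first exact: beta_character.
  apply: (bichar_inj betaP beta_nondeg) => w.
  by rewrite phiP //; apply: beta_character.
move=> chi chi' chiG chiG'; apply: (bichar_inj betaP beta_nondeg) => w.
have [_ bl _ _] := betaP; rewrite bl !phiP //=.
have [c0 cM] := chiG; have [c0' cM'] := chiG'.
by split=> [t|u v]; rewrite /= ?mulf_neq0 // cM cM' mulrACA.
Qed.

(** * The stabilizer for non-real [beta] *)

Section NotReal.
Hypothesis beta_nreal : beta <> (fun u v => (beta u v)^*%C).

Lemma stab_flag_false psi : grading_stab Gamma psi -> conj_flag psi = false.
Proof.
move=> psiG; have := induced_beta (stab_aut psiG) (stab_induces psiG).
case: conj_flag => // E; case: beta_nreal.
by apply: funext => u; apply: funext => v; apply: E.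
Qed.

Lemma stab_inner psi : grading_stab Gamma psi -> inner_automorphism psi.
Proof.
move=> psiG; have fE := stab_flag_false psiG.
have [u uP] := character_ex (stab_coef_character psiG fE).
exists (gen u); first exact: gen_unit.
move=> x; rewrite (coordP x) linear_sum mulr_sumr mulr_suml.
(* Multiplying by [gen u] clears the inverse; what remains is the commutation relation of [gen u]
   and [gen t]. *)
apply: eq_bigr => t _ /=; apply: (mulIr (gen_unit u)).
rewrite mulrVK ?gen_unit // stab_gen // fE -uP rmorphM.
rewrite [RHS]mulrA -[gen u * iota _]iotaC.
rewrite -!mulrA; congr (_ * _).
by rewrite [gen u * _](betaC (gen_component u) (gen_component t)).
Qed.

Lemma stab_character_iso : isomorphic_groups
  (grading_stab Gamma) (fun psi psi' => (psi \o psi')%AF)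
  (character_group R T) character_mul.
Proof.
exists (fun psi => scoef psi); split.
  split=> [psi psiG|psi psi' /set_mem psiG /set_mem psiG' E|chi chiG].
  - exact: stab_coef_character (stab_flag_false psiG).
  - by apply: stab_eq; rewrite ?stab_flag_false // E.
  - by have [psi psiG [_ E]] := stab_character_ex chiG; exists psi.
move=> psi psi' psiG psiG'; apply: funext => t.
by have [_ _ ->] := stab_comp psiG psiG'; rewrite stab_flag_false //= mulrC.
Qed.

End NotReal.

(** * The stabilizer for real [beta] *)

Section RealBeta.
Hypothesis beta_real : beta = (fun u v => (beta u v)^*%C).

Lemma beta_conj u v : (beta u v)^*%C = beta u v.
Proof. by rewrite [in RHS]beta_real. Qed.

(** Here [d] holds the scalars of a semilinear element of the stabilizer. Multiplying its relation
    by the conjugate relation cancels [sigma], so the squared modulus of [d] is a nonnegative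
    character, hence trivial. *)
Lemma real_twist_ex : exists d : T -> R[i],
  [/\ forall t, d t != 0, forall t, d t * (d t)^*%C = 1
    & forall u v, d u * d v * sigma u v = (sigma u v)^*%C * d (u + v)].
Proof.
have [u v|d [d0 dM]] := @twist_ex true id (fun _ _ => erefl).
  by rewrite /= beta_conj.
exists d; split=> // t.
pose chi t := d t * (d t)^*%C.
have chiG : character_group R T chi.
  split=> [u|u v]; first by rewrite mulf_neq0 ?conjc_eq0.
  have s0 := sigma_neq0 u v.
  have s0' : (sigma u v)^*%C != 0 by rewrite conjc_eq0.
  apply: (mulIf (mulf_neq0 s0 s0')).
  have : (d u * d v * sigma u v) * (d u * d v * sigma u v)^*%C =
     ((sigma u v)^*%C * d (u + v)) * ((sigma u v)^*%C * d (u + v))^*%C.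
    by rewrite dM.
  rewrite !rmorphM /= conjcK /chi => E.
  transitivity ((sigma u v)^*%C * d (u + v) * (sigma u v * (d (u + v))^*%C)).
    by ring.
  by rewrite -E; ring.
by apply: (char_nonneg chiG); apply: mulcJ_ge0.
Qed.

Lemma stab_supp_iso : isomorphic_groups
  (grading_stab Gamma) (fun psi psi' => (psi \o psi')%AF)
  [set: T * 'Z_2] +%R.
Proof.
have [d [d0 dd dM]] := real_twist_ex.
(* Dividing out [d] in the semilinear case leaves a character in both cases; the element of [T]
   representing it will be the first coordinate of the isomorphism. *)
pose chi psi t := scoef psi t / d t ^+ conj_flag psi.
have dn0 t n : d t ^+ n != 0 by rewrite expf_neq0.
have chiG psi : grading_stab Gamma psi -> character_group R T (chi psi).
  move=> psiG; rewrite /chi; split=> [t|u v].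
    by rewrite mulf_neq0 ?invr_eq0 ?stab_coef_neq0.
  have cM := stab_coefM u v psiG; move: cM.
  case: conj_flag => /= cM; last first.
    rewrite !expr0 !divr1; apply: (mulIf (sigma_neq0 u v)).
    by rewrite cM mulrC.
  rewrite !expr1 mulf_div; apply/eqP; rewrite eqr_div ?mulf_neq0 //; apply/eqP.
  have s0 : (sigma u v)^*%C != 0 by rewrite conjc_eq0 sigma_neq0.
  by apply: (mulfI s0); rewrite [LHS]mulrA -cM [RHS]mulrCA -dM; ring.
have ex psi : exists u,
    grading_stab Gamma psi -> forall t, beta u t = chi psi t.
  have [/chiG /character_ex [u uP]|] := pselect (grading_stab Gamma psi).
    by exists u.
  by exists 0.
have [phi phiP] := choice ex.
exists (fun psi => (phi psi, (conj_flag psi)%:R)); split.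
  split=> // [psi psi' /set_mem psiG /set_mem psiG' [E F]|[u e] _].
    have fE : conj_flag psi = conj_flag psi'.
      by move: F; case: conj_flag; case: conj_flag.
    apply: stab_eq => // t; apply: (mulIf (invr_neq0 (dn0 t (conj_flag psi)))).
    by rewrite -/(chi psi t) -phiP // E phiP // /chi fE.
  have [b bE] : exists b : bool, e = b%:R.
    case: e => [[|[|//]]] i; [exists false|exists true]; exact: val_inj.
  have [|v w|psi psiG [fE cE]] := @stab_ex b (fun t => beta u t * d t ^+ b).
  - by move=> t; have [b0 _ _ _] := betaP; rewrite mulf_neq0.
  - have [_ _ br _] := betaP; rewrite br.
    rewrite mulrACA -[LHS]mulrA [RHS]mulrCA; congr (_ * _).
    by case: (b); rewrite /= ?expr1 ?dM // !expr0 !mulr1 mul1r.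
  exists psi => //; rewrite fE bE; congr (_, _).
  apply: (bichar_inj betaP beta_nondeg) => w.
  by rewrite phiP // /chi fE cE mulfK.
move=> psi psi' psiG psiG'; have [compG fE cE] := stab_comp psiG psiG'.
congr (_, _); last first.
  by rewrite fE; case: conj_flag; case: conj_flag; apply: val_inj.
apply: (bichar_inj betaP beta_nondeg) => w.
have [_ bl _ _] := betaP; rewrite bl !phiP // /chi fE cE.
(* Every character is some [beta u], hence real, so conjugation acts trivially on it and the product
   is direct. *)
have chi_real : (chi psi' w)^*%C = chi psi' w by rewrite -phiP // beta_conj.
have -> : scoef psi' w = chi psi' w * d w ^+ conj_flag psi' by rewrite divfK.
rewrite mulfK // rmorphM.
have -> : conj_if (conj_flag psi) (chi psi' w) = chi psi' w.
  by case: conj_flag.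
have dV : (d w)^*%C = (d w)^-1 by rewrite -[RHS]mul1r -(dd w) mulrC mulKf.
(* The powers of [d] match in all four cases; for two semilinear maps this uses that [d] has modulus
   1, so that the automorphism with scalars [d] is an involution. *)
have K : conj_if (conj_flag psi) (d w ^+ conj_flag psi') /
    d w ^+ (conj_flag psi (+) conj_flag psi') = (d w ^+ conj_flag psi)^-1.
  case: (conj_flag psi); case: (conj_flag psi').
  - by rewrite !expr1 expr0 divr1; apply: dV.
  - by rewrite !expr0 rmorph1 !expr1 mul1r.
  - by rewrite !expr1 expr0 invr1; apply: (mulfV (d0 w)).
  - by rewrite !expr0 rmorph1 divr1 invr1.
by rewrite -K [RHS]mulrC -2![LHS]mulrA; congr (_ * _); rewrite mulrCA.
Qed.

End RealBeta.
End Stabilizer.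

End TwistedGroupAlgebra.

Theorem proposition18 (R : realType) (G : zmodType) (D : falgType R)
    (hD : complex_matrix_algebra D)
    (Gamma : division_grading G D) (hGamma : type_2f Gamma)
    (iota : {rmorphism R[i] -> D}) (hiota : identity_component_iso Gamma iota)
    (beta : supp Gamma -> supp Gamma -> R[i])
    (hbeta : alternating_bicharacter beta)
    (hcomm : commutation iota beta) :
  weyl_group Gamma =
    [set f : supp Gamma -> supp Gamma | group_automorphism f /\
      ((forall u v, beta (f u) (f v) = beta u v) \/
       (forall u v, beta (f u) (f v) = (beta u v)^*))] /\
  (beta <> (fun u v => (beta u v)^*) ->
     (forall psi, grading_stab Gamma psi -> inner_automorphism psi) /\
     isomorphic_groups
       (grading_stab Gamma) (fun psi psi' => (psi \o psi')%AF)
       (character_group R (supp Gamma)) character_mul /\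
     isomorphic_groups
       (character_group R (supp Gamma)) character_mul
       [set: supp Gamma] +%R) /\
  (beta = (fun u v => (beta u v)^*) ->
     isomorphic_groups
       (grading_stab Gamma) (fun psi psi' => (psi \o psi')%AF)
       [set: supp Gamma * 'Z_2] +%R).
Proof.
split; first exact: (weyl_groupE hGamma hiota hbeta hcomm).
split=> [beta_nreal|beta_real].
  split; first exact: (stab_inner hGamma hiota hbeta hcomm beta_nreal).
  split; first exact: (stab_character_iso hGamma hiota hcomm beta_nreal).
  exact: (character_supp_iso hGamma hiota hbeta hcomm).
exact: (stab_supp_iso hGamma hiota hbeta hcomm beta_real).
Qed.
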